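(* Let $F_1=\{f_1,\dots,f_\mu\}$ and $F_2=\{f_{\mu+1},\dots,f_\nu\}$ be two ordered finite sets of mappings $f_k:\mathbb{R}^m\times\mathbb{R}^m\to\mathscr{I}^{p,q}$, let $C\in C\ell_{p,q}$, and let $A,B:\mathbb{R}^m\to C\ell_{p,q}$ be two multivector fields. (1) If $A(x)=C\,B(x)$ for all $x$ and the GFT $\mathcal{F}_{F_1,F_2}$ is left separable, then for all $u\in\mathbb{R}^m$ $$\mathcal{F}_{F_1,F_2}(A)(u)=\sum_{j\in\{0,1\}^{\mu}}C_{c^{j}(\overleftarrow{F_1})}(u)\,\mathcal{F}_{F_1(j),F_2}(B)(u).$$ (2) If $A(x)=B(x)\,C$ for all $x$ and the GFT $\mathcal{F}_{F_1,F_2}$ is right separable, then for all $u\in\mathbb{R}^m$ $$\mathcal{F}_{F_1,F_2}(A)(u)=\sum_{k\in\{0,1\}^{\nu-\mu}}\mathcal{F}_{F_1,F_2(k)}(B)(u)\,C_{c^{k}(\overrightarrow{F_2})}(u).$$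
   Context: $C\ell_{p,q}$, $p+q=n\in\mathbb{N}$, is the real associative unital geometric (Clifford) algebra of dimension $2^n$ generated by $e_1,\dots,e_n$ with $e_je_k+e_ke_j=2\epsilon_j\delta_{jk}$, $\epsilon_j=1$ for $j\le p$, $\epsilon_j=-1$ for $j>p$. Its elements are called multivectors; a multivector field is a map $\mathbb{R}^m\to C\ell_{p,q}$. The exponential of a multivector is $e^{A}=\sum_{j\ge0}A^j/j!$. $\mathscr{I}^{p,q}=\{0\}\cup\{i\in C\ell_{p,q}: i^2 \text{ is a negative real number}\}$. GFT: for ordered finite sets $F_1=\{f_1,\dots,f_\mu\}$, $F_2=\{f_{\mu+1},\dots,f_\nu\}$ of mappings $f_k:\mathbb{R}^m\times\mathbb{R}^m\to\mathscr{I}^{p,q}$, $$\mathcal{F}_{F_1,F_2}(A)(u)=\int_{\mathbb{R}^m}\prod_{f\in F_1}e^{-f(x,u)}\,A(x)\prod_{f\in F_2}e^{-f(x,u)}\,d^mx,$$ with products taken from left to right in increasing order of the index (empty product $=1$). All multivector fields are assumed to be such that the integrals defining the transforms in the statement exist. Separability: the GFT is left (respectively right) separable if for every $l=1,\dots,\mu$ (respectively $l=\mu+1,\dots,\nu$) one has $f_l(x,u)=g_l(x,u)\,i_l(u)$ with a real-valued function $g_l:\mathbb{R}^m\times\mathbb{R}^m\to\mathbb{R}$ and a function $i_l:\mathbb{R}^m\to\mathscr{I}^{p,q}$ not depending on $x$. Decomposition: for an invertible multivector $B$, $A_{c^0(B)}=\frac12(A+B^{-1}AB)$ and $A_{c^1(B)}=\frac12(A-B^{-1}AB)$;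 for $B=0$, $A_{c^0(0)}=A$ and $A_{c^1(0)}=0$. For an ordered tuple $(B_1,\dots,B_d)$ and $j\in\{0,1\}^d$, $$A_{c^{j}(\overrightarrow{B_1,\dots,B_d})}=((A_{c^{j_1}(B_1)})_{c^{j_2}(B_2)}\dots)_{c^{j_d}(B_d)},\qquad A_{c^{j}(\overleftarrow{B_1,\dots,B_d})}=((A_{c^{j_d}(B_d)})_{c^{j_{d-1}}(B_{d-1})}\dots)_{c^{j_1}(B_1)}.$$ For an ordered set $F=\{f_1,\dots,f_d\}$ of functions of the form $f_l(x,u)=g_l(x,u)i_l(u)$, with real-valued functions $g_l:\mathbb{R}^m\times\mathbb{R}^m\to\mathbb{R}$ and functions $i_l:\mathbb{R}^m\to\mathscr{I}^{p,q}$ not depending on $x$, $A_{c^j(\overleftarrow F)}(u)$ and $A_{c^j(\overrightarrow F)}(u)$ denote these decompositions with respect to the tuple $(i_1(u),\dots,i_d(u))$ (the same as with respect to $(f_1(x,u),\dots,f_d(x,u))$ whenever these are all nonzero). Sign changes: for $F=\{f_1,\dots,f_d\}$ and $j\in\{0,1\}^d$, $F(j)=\{(-1)^{j_1}f_1,\dots,(-1)^{j_d}f_d\}$. *)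

(* Defs.v *)
From HB Require Import structures.
From mathcomp Require Import all_boot all_order all_algebra all_field.
From mathcomp Require Import all_classical all_reals all_analysis.
From mathcomp Require Import ring.

Set Implicit Arguments.
Unset Strict Implicit.
Unset Printing Implicit Defensive.

Import Order.TTheory GRing.Theory Num.Theory.
Import numFieldNormedType.Exports.

Local Open Scope classical_set_scope.
Local Open Scope ring_scope.

(******************************************************************************)
(* The Clifford algebra Cl(p,q)                                               *)
(*                                                                            *)
(* A multivector is given by its coordinates in the basis of the blades       *)
(* e_S = e_(i_1) ... e_(i_r), for S = {i_1 < ... < i_r} a set of indices.     *)
(* Indices start at 0, so that e_j squares to 1 for j < p and to -1 for       *)
(* p <= j < p + q. The product is e_S e_T = blade_sign S T *: e_(S (+) T):    *)
(* each pair i in S, j in T with j < i costs one transposition, and each      *)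
(* index common to S and T contributes its square.                            *)
(* The lemmas clifford_relation, blade_prod, clifford_blade_sum and           *)
(* clifford_dim state that this is the algebra of dimension 2 ^ (p + q)       *)
(* generated by the e_j subject to e_j e_k + e_k e_j = 2 eps_j delta_jk.      *)
(******************************************************************************)

Definition clifford (R : realType) (p q : nat) : Type :=
  {ffun {set 'I_(p + q)} -> R^o}.

HB.instance Definition _ (R : realType) (p q : nat) :=
  Vector.copy (clifford R p q) {ffun {set 'I_(p + q)} -> R^o}.

Definition symdiff (n : nat) (S T : {set 'I_n}) : {set 'I_n} :=
  [set i | (i \in S) (+) (i \in T)]%SET.

Section Clifford.
Variables (R : realType) (p q : nat).
Local Notation n := (p + q)%N.
Local Notation Cl := (clifford R p q).
Implicit Types (A B C : Cl) (S T U : {set 'I_n}).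

Definition mvcoef A S : R := fun_of_fin A S.

Definition eps (j : 'I_n) : R := if (j < p)%N then 1 else -1.

Definition index_sign (i j : 'I_n) : R :=
  if (j < i)%N then -1 else if i == j then eps i else 1.

Definition blade_sign S T : R := \prod_(i in S) \prod_(j in T) index_sign i j.

Definition blade S : Cl := [ffun T => (T == S)%:R].

Definition basis_vector (j : 'I_n) : Cl := blade [set j]%SET.

Definition clifford_mul A B : Cl :=
  [ffun U => \sum_S blade_sign S (symdiff S U) *
                    (mvcoef A S * mvcoef B (symdiff S U))].

Lemma mvcoefP A B : mvcoef A =1 mvcoef B -> A = B.
Proof. by move=> AB; apply/ffunP. Qed.

Lemma mvcoefD A B S : mvcoef (A + B) S = mvcoef A S + mvcoef B S.
Proof. by rewrite /mvcoef ffunE. Qed.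

Lemma mvcoefZ (a : R) A S : mvcoef (a *: A) S = a * mvcoef A S.
Proof. by rewrite /mvcoef ffunE. Qed.

Lemma mvcoef_blade S T : mvcoef (blade S) T = (T == S)%:R.
Proof. by rewrite /mvcoef ffunE. Qed.

Lemma mvcoef_mul A B U : mvcoef (clifford_mul A B) U =
  \sum_S blade_sign S (symdiff S U) * (mvcoef A S * mvcoef B (symdiff S U)).
Proof. by rewrite /mvcoef ffunE. Qed.

Lemma symdiffA S T U : symdiff S (symdiff T U) = symdiff (symdiff S T) U.
Proof. by apply/setP => i; rewrite !inE addbA. Qed.

Lemma symdiffK S : involutive (symdiff S).
Proof. by move=> T; apply/setP => i; rewrite !inE addKb. Qed.

Lemma symdiff0s S : symdiff finset.set0 S = S.
Proof. by apply/setP => i; rewrite !inE. Qed.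

Lemma symdiffs0 S : symdiff S finset.set0 = S.
Proof. by apply/setP => i; rewrite !inE addbF. Qed.

Lemma symdiffss S : symdiff S S = finset.set0.
Proof. by apply/setP => i; rewrite !inE addbb. Qed.

Lemma eps_sq j : eps j * eps j = 1.
Proof. by rewrite /eps; case: ifP => _; rewrite ?mulrNN mulr1. Qed.

Lemma index_sign_sq i j : index_sign i j * index_sign i j = 1.
Proof.
rewrite /index_sign; case: ifP => _; first by rewrite mulrNN mulr1.
by case: ifP => _; rewrite ?eps_sq ?mulr1.
Qed.

Lemma prod_symdiff (f : 'I_n -> R) S T : (forall i, f i * f i = 1) ->
  \prod_(i in symdiff S T) f i = \prod_(i in S) f i * \prod_(i in T) f i.
Proof.
move=> ff; rewrite [LHS]big_mkcond [X in _ = X * _]big_mkcond.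
rewrite [X in _ = _ * X]big_mkcond -big_split /=; apply: eq_bigr => i _.
by rewrite inE; case: (i \in S); case: (i \in T); rewrite ?ff ?mulr1 ?mul1r.
Qed.

Lemma blade_signDl S T U :
  blade_sign (symdiff S T) U = blade_sign S U * blade_sign T U.
Proof.
apply: prod_symdiff => i /=; rewrite -big_split /= big1 // => j _.
exact: index_sign_sq.
Qed.

Lemma blade_signDr S T U :
  blade_sign S (symdiff T U) = blade_sign S T * blade_sign S U.
Proof.
rewrite /blade_sign -big_split /=; apply: eq_bigr => i _.
by apply: prod_symdiff => j /=; exact: index_sign_sq.
Qed.

Lemma blade_sign0s S : blade_sign finset.set0 S = 1.
Proof. by rewrite /blade_sign big_set0. Qed.

Lemma blade_signs0 S : blade_sign S finset.set0 = 1.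
Proof. by rewrite /blade_sign big1 // => i _; rewrite big_set0. Qed.

Lemma blade_sign_sq S T : blade_sign S T * blade_sign S T = 1.
Proof. by rewrite -blade_signDr symdiffss blade_signs0. Qed.

Lemma clifford_mulA : associative clifford_mul.
Proof.
move=> A B C; apply: mvcoefP => U; rewrite !mvcoef_mul.
transitivity (\sum_S \sum_T blade_sign S (symdiff S U) * (mvcoef A S *
   (blade_sign (symdiff S T) (symdiff T U) *
    (mvcoef B (symdiff S T) * mvcoef C (symdiff T U))))).
  apply: eq_bigr => S _; rewrite mvcoef_mul mulr_sumr mulr_sumr.
  rewrite (reindex_inj (inv_inj (symdiffK S))); apply: eq_bigr => T _.
  suff -> : symdiff (symdiff S T) (symdiff S U) = symdiff T U by [].
  by apply/setP => i; rewrite !inE; do 3![case: (_ \in _)].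
rewrite exchange_big; apply: eq_bigr => T _ /=.
rewrite mvcoef_mul mulr_suml mulr_sumr; apply: eq_bigr => S _.
rewrite !blade_signDl !blade_signDr.
have := blade_sign_sq S U.
move: (blade_sign S S) (blade_sign S U) (blade_sign S T) (blade_sign T T)
  (blade_sign T U) => ss su st tt tu su2.
move: (mvcoef A S) (mvcoef B _) (mvcoef C _) => a b c.
transitivity (su * su * (ss * a * st * tt * tu * b * c)); first by ring.
by rewrite su2; ring.
Qed.

Lemma clifford_mul1l : left_id (blade finset.set0) clifford_mul.
Proof.
move=> A; apply: mvcoefP => U; rewrite mvcoef_mul (bigD1 finset.set0) //=.
rewrite mvcoef_blade eqxx symdiff0s blade_sign0s !mul1r big1 ?addr0 // => S.
by move=> /negbTE S0; rewrite mvcoef_blade S0 mul0r mulr0.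
Qed.

Lemma clifford_mul1r : right_id (blade finset.set0) clifford_mul.
Proof.
move=> A; apply: mvcoefP => U; rewrite mvcoef_mul (bigD1 U) //=.
rewrite mvcoef_blade symdiffss eqxx blade_signs0 mulr1 mul1r big1 ?addr0 // => S SU.
rewrite mvcoef_blade; case: eqP => [E|]; last by rewrite !mulr0.
by move: SU; rewrite -(symdiffK S U) E symdiffs0 eqxx.
Qed.

Lemma clifford_mulDl : left_distributive clifford_mul +%R.
Proof.
move=> A B C; apply: mvcoefP => U; rewrite mvcoefD !mvcoef_mul -big_split /=.
by apply: eq_bigr => S _; rewrite mvcoefD; ring.
Qed.

Lemma clifford_mulDr : right_distributive clifford_mul +%R.
Proof.
move=> A B C; apply: mvcoefP => U; rewrite mvcoefD !mvcoef_mul -big_split /=.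
by apply: eq_bigr => S _; rewrite mvcoefD; ring.
Qed.

Lemma clifford_1neq0 : blade finset.set0 != 0.
Proof.
apply/eqP => /(congr1 (mvcoef^~ finset.set0)).
by rewrite mvcoef_blade eqxx /mvcoef ffunE => /eqP; rewrite oner_eq0.
Qed.

HB.instance Definition _ := GRing.Zmodule_isNzRing.Build Cl
  clifford_mulA clifford_mul1l clifford_mul1r clifford_mulDl clifford_mulDr
  clifford_1neq0.

Lemma clifford_scaleAl (a : R) A B : a *: (A * B) = (a *: A) * B.
Proof.
apply: mvcoefP => U; rewrite mvcoefZ !mvcoef_mul mulr_sumr.
by apply: eq_bigr => S _; rewrite mvcoefZ; ring.
Qed.

HB.instance Definition _ := GRing.Lmodule_isLalgebra.Build R Cl clifford_scaleAl.

Lemma clifford_scaleAr (a : R) A B : a *: (A * B) = A * (a *: B).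
Proof.
apply: mvcoefP => U; rewrite mvcoefZ !mvcoef_mul mulr_sumr.
by apply: eq_bigr => S _; rewrite mvcoefZ; ring.
Qed.

HB.instance Definition _ := GRing.Lalgebra_isAlgebra.Build R Cl clifford_scaleAr.

HB.instance Definition _ := Algebra_isFalgebra.Build R Cl.

Lemma mvcoef_sum I (r : seq I) (P : pred I) (F : I -> Cl) S :
  mvcoef (\sum_(i <- r | P i) F i) S = \sum_(i <- r | P i) mvcoef (F i) S.
Proof.
by elim/big_rec2: _ => [|i x y _ <-]; [rewrite /mvcoef ffunE|rewrite mvcoefD].
Qed.

Lemma bladeM S T : blade S * blade T = blade_sign S T *: blade (symdiff S T).
Proof.
apply: mvcoefP => U; rewrite mvcoefZ mvcoef_mul mvcoef_blade (bigD1 S) //=.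
rewrite !mvcoef_blade eqxx mul1r big1 ?addr0 => [|V /negbTE VS]; last first.
  by rewrite mvcoef_blade VS mul0r mulr0.
have -> : (symdiff S U == T) = (U == symdiff S T).
  by apply/eqP/eqP => [<-|->]; rewrite symdiffK.
by case: eqP => [->|]; rewrite ?symdiffK // !mulr0.
Qed.

Lemma clifford_relation (j k : 'I_n) :
  basis_vector j * basis_vector k + basis_vector k * basis_vector j =
  (2 * eps j * (j == k)%:R)%:A.
Proof.
rewrite /basis_vector !bladeM /blade_sign !finset.big_set1 /index_sign.
have [<-|jk] := eqVneq j k.
  rewrite ltnn symdiffss; by rewrite -scalerDl mulr1 -mulr2n mulr_natl.
have -> : symdiff [set k]%SET [set j]%SET = symdiff [set j]%SET [set k]%SET.
  by apply/setP => i; rewrite !inE addbC.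
rewrite -scalerDl mulr0 scale0r.
case: ltngtP => [||/ord_inj kj]; rewrite ?addNr ?subrr ?scale0r //.
by rewrite kj eqxx in jk.
Qed.

Lemma blade_prod S : blade S = \prod_(i in S) basis_vector i.
Proof.
rewrite -big_filter; set s := seq.filter _ _.
have s_sorted : sorted (relpre val ltn) s.
  apply: sorted_filter => [i j k|]; first exact: ltn_trans.
  rewrite [index_enum _]unlock -enumT -sorted_map val_enum_ord.
  exact: iota_ltn_sorted.
have -> : S = [set i in s]%SET.
  by apply/setP => i; rewrite inE mem_filter mem_index_enum andbT.
elim: s s_sorted => [|i s IHs] /= is_sorted.
  rewrite big_nil; congr blade; by apply/setP => i; rewrite !inE.
rewrite big_cons -IHs ?(path_sorted is_sorted) // bladeM.
have ltis j : j \in s -> (i < j)%N.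
  by move: j; apply/allP; apply: order_path_min is_sorted => a b c; exact: ltn_trans.
have -> : blade_sign [set i]%SET [set j in s]%SET = 1.
  rewrite /blade_sign finset.big_set1 big1 // => j; rewrite inE => /ltis ij.
  by rewrite /index_sign ltnNge ltnW //= -val_eqE /= ltn_eqF.
rewrite scale1r; congr blade; apply/setP => j; rewrite !inE.
by case: eqVneq => [->|//] /=; apply/esym; apply/negP => /ltis; rewrite ltnn.
Qed.

Lemma clifford_blade_sum A : A = \sum_S mvcoef A S *: blade S.
Proof.
apply: mvcoefP => U; rewrite mvcoef_sum (bigD1 U) //= mvcoefZ mvcoef_blade.
rewrite eqxx mulr1 big1 ?addr0 // => S /negbTE SU.
by rewrite mvcoefZ mvcoef_blade eq_sym SU mulr0.
Qed.

Lemma clifford_dim : \dim {:Cl} = (2 ^ n)%N.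
Proof.
rewrite dimvf; have -> : dim Cl = (#|{set 'I_n}| * 1)%N by [].
by rewrite muln1 -cardsT -powersetT card_powerset cardsT card_ord.
Qed.

End Clifford.

(******************************************************************************)
(* Lebesgue measure and integration on R^m                                    *)
(*                                                                            *)
(* Lebesgue measure is Caratheodory's restriction of Lebesgue outer measure   *)
(* to its measurable sets, so that it is complete and the measurable          *)
(* functions are the Lebesgue (and not only the Borel) measurable ones.       *)
(******************************************************************************)

Section Lebesgue.
Variables (R : realType) (m : nat).
Local Notation vec := 'rV[R]_m.
Local Open Scope ereal_scope.

Definition box (ab : vec * vec) : set vec :=
  [set x | forall i, (ab.1 ord0 i < x ord0 i <= ab.2 ord0 i)%R].

Definition box_volume (ab : vec * vec) : \bar R :=
  (\prod_(i < m) Num.max (ab.2 ord0 i - ab.1 ord0 i) 0)%:E.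

(* The covers are countable, possibly finite: for m = 0 no box is empty, and  *)
(* only the empty cover gives the empty set outer measure 0.                  *)
Definition box_cover (X : set vec) : set (set nat * (nat -> vec * vec)) :=
  [set DB | X `<=` \bigcup_(k in DB.1) box (DB.2 k)].

Definition lebesgue_outer (X : set vec) : \bar R :=
  ereal_inf [set \esum_(k in DB.1) box_volume (DB.2 k) | DB in box_cover X].

Lemma box_volume_ge0 ab : 0 <= box_volume ab.
Proof. by rewrite lee_fin prodr_ge0 // => i _; rewrite le_max lexx orbT. Qed.

Lemma lebesgue_outer_ge0 X : 0 <= lebesgue_outer X.
Proof.
apply: le_ereal_inf_tmp => _ [DB _ <-]; apply: esum_ge0 => k _.
exact: box_volume_ge0.
Qed.

Lemma lebesgue_outer0 : lebesgue_outer set0 = 0.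
Proof.
apply/eqP; rewrite eq_le lebesgue_outer_ge0 andbT; apply: ereal_inf_lbound.
by exists (set0, fun=> (0%R, 0%R)) => /=; [exact: sub0set|rewrite esum_set0].
Qed.

Lemma le_lebesgue_outer :
  {homo lebesgue_outer : X Y / X `<=` Y >-> X <= Y}.
Proof.
move=> X Y XY; apply: ereal_inf_le_tmp => _ [DB YDB <-].
by exists DB => //; exact: subset_trans XY YDB.
Qed.

Lemma lebesgue_outer_sigma_subadditive : sigma_subadditive lebesgue_outer.
Proof.
move=> X; have [[i ioo]|] := pselect (exists i, lebesgue_outer (X i) = +oo).
  rewrite (eseries_pinfty _ _ ioo) ?leey// => n _.
  by rewrite -ltNye (lt_le_trans _ (lebesgue_outer_ge0 _)).
rewrite -forallNE => Xoo; apply/lee_addgt0Pr => e e0.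
apply: le_trans (epsilon_trick xpredT (fun n => lebesgue_outer_ge0 (X n))
  (ltW e0)).
have [G GX] : {G : nat -> set nat * (nat -> vec * vec) & forall n,
    box_cover (X n) (G n) /\ \esum_(k in (G n).1) box_volume ((G n).2 k) <=
    lebesgue_outer (X n) + (e / (2 ^ n.+1)%:R)%:E}.
  apply: (@choice _ _ (fun n H => box_cover (X n) H /\
    \esum_(k in H.1) box_volume (H.2 k) <=
    lebesgue_outer (X n) + (e / (2 ^ n.+1)%:R)%:E)) => n.
  have en0 : (0 < e / (2 ^ n.+1)%:R)%R by rewrite divr_gt0 // ltr0n expn_gt0.
  have fX : lebesgue_outer (X n) \is a fin_num.
    by rewrite ge0_fin_numE ?lebesgue_outer_ge0 // ltey; apply/eqP/Xoo.
  have [_ [H HX <-] /ltW He] := lb_ereal_inf_adherent en0 fX.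
  by exists H.
have vol0 n k : 0 <= box_volume ((G n).2 k) by exact: box_volume_ge0.
apply: (@le_trans _ _ (\sum_(n <oo) \esum_(k in (G n).1) box_volume ((G n).2 k)));
  last first.
  apply: lee_nneseries => n _; last exact: (GX n).2.
  by move=> _; exact: esum_ge0.
rewrite nneseries_esumT => [|n]; last exact: esum_ge0.
rewrite esum_esum //; set P := _ `*`` _.
pose unp k := odflt (0%N, 0%N) (unpickle k : option (nat * nat)).
have unpK x : unp (pickle x) = x by rewrite /unp pickleK.
apply: ereal_inf_lbound.
exists (pickle @` P, fun k => (G (unp k).1).2 (unp k).2).
  move=> x [n _ /(GX n).1[k kD xk]] /=; exists (pickle (n, k)).
    by exists (n, k).
  by rewrite /= unpK.
rewrite /= esum_image; first by apply: eq_esum => nk _; rewrite unpK.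
by move=> x y _ _; exact: (pcan_inj pickleK).
Qed.

HB.instance Definition _ := isOuterMeasure.Build R vec lebesgue_outer
  lebesgue_outer0 lebesgue_outer_ge0 le_lebesgue_outer
  lebesgue_outer_sigma_subadditive.

Definition lebesgue_space : measurableType _ := caratheodory_type lebesgue_outer.

Definition lebesgue : set lebesgue_space -> \bar R := lebesgue_outer.

Let lebesgue0 : lebesgue set0 = 0.
Proof. exact: lebesgue_outer0. Qed.

Let lebesgue_ge0 X : 0 <= lebesgue X.
Proof. exact: lebesgue_outer_ge0. Qed.

Let lebesgue_semi_sigma_additive : semi_sigma_additive lebesgue.
Proof. by move=> F mF tF mUF; exact: caratheodory_measure_sigma_additive. Qed.

HB.instance Definition _ := isMeasure.Build _ _ _ lebesgue
  lebesgue0 lebesgue_ge0 lebesgue_semi_sigma_additive.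

End Lebesgue.

Arguments lebesgue {R} m.

Section GFT.
Variables (R : realType) (p q m : nat).
Local Notation Cl := (clifford R p q).
Local Notation vec := 'rV[R]_m.

(* Cl is finite dimensional: limits and integrals are taken coordinatewise.   *)
Definition mvexp (A : Cl) : Cl :=
  [ffun S => limn (fun N => mvcoef (\sum_(0 <= j < N) j`!%:R^-1 *: A ^+ j) S)].

Definition mvintegrable (F : vec -> Cl) : Prop :=
  forall S, (lebesgue m).-integrable setT (fun x => (mvcoef (F x) S)%:E).

Definition mvintegral (F : vec -> Cl) : Cl :=
  [ffun S => \int[lebesgue m]_(x in setT) mvcoef (F x) S].

Definition imaginary_units : set Cl :=
  [set i | i = 0 \/ exists2 r : R, r < 0 & i ^+ 2 = r%:A].

(* An ordered set {f_1, ..., f_d} of mappings, indexed from 0.                *)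
Definition kernels (d : nat) : Type := 'I_d -> vec -> vec -> Cl.

Definition imaginary_kernels (d : nat) (F : kernels d) : Prop :=
  forall l x u, imaginary_units (F l x u).

Definition gft_integrand (d1 d2 : nat) (F1 : kernels d1) (F2 : kernels d2)
    (A : vec -> Cl) (u x : vec) : Cl :=
  (\prod_(l < d1) mvexp (- F1 l x u)) * A x * \prod_(l < d2) mvexp (- F2 l x u).

Definition gft_exists (d1 d2 : nat) (F1 : kernels d1) (F2 : kernels d2)
    (A : vec -> Cl) : Prop :=
  forall u, mvintegrable (gft_integrand F1 F2 A u).

Definition gft (d1 d2 : nat) (F1 : kernels d1) (F2 : kernels d2)
    (A : vec -> Cl) (u : vec) : Cl :=
  mvintegral (gft_integrand F1 F2 A u).

(* The GFT with kernels F1, F2 is left (right) separable when F1 (F2) has a   *)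
(* separation g, i.                                                           *)
Definition separation (d : nat) (F : kernels d)
    (g : 'I_d -> vec -> vec -> R) (i : 'I_d -> vec -> Cl) : Prop :=
  (forall l u, imaginary_units (i l u)) /\
  (forall l x u, F l x u = g l x u *: i l u).

Definition flip_signs (d : nat) (j : {ffun 'I_d -> bool}) (F : kernels d) :
    kernels d :=
  fun l x u => (-1) ^+ (j l) *: F l x u.

(* b = false (true) gives the component c^0 (c^1), which commutes             *)
(* (anticommutes) with B when B ^+ 2 is a nonzero real number.                *)
Definition cpart (b : bool) (B A : Cl) : Cl :=
  if B == 0 then (if b then 0 else A)
  else 2^-1 *: (A + (-1) ^+ b *: (B^-1 * A * B)).

(* The component with respect to B_1 is taken first in cpart_right (foldl),   *)
(* the one with respect to B_d first in cpart_left (foldr).                   *)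
Definition cpart_right (d : nat) (j : {ffun 'I_d -> bool}) (B : 'I_d -> Cl)
    (A : Cl) : Cl :=
  foldl (fun X l => cpart (j l) (B l) X) A (enum 'I_d).

Definition cpart_left (d : nat) (j : {ffun 'I_d -> bool}) (B : 'I_d -> Cl)
    (A : Cl) : Cl :=
  foldr (fun l X => cpart (j l) (B l) X) A (enum 'I_d).

End GFT.

(* Main.v *)
Require Import Defs.
From mathcomp Require Import all_boot all_order all_algebra all_field.
From mathcomp Require Import all_classical all_reals all_analysis.

Set Implicit Arguments.
Unset Strict Implicit.
Unset Printing Implicit Defensive.

Import Order.TTheory GRing.Theory Num.Theory.
Import numFieldNormedType.Exports.

Local Open Scope ring_scope.

(** The factors e^(-f) of the transform do not commute with the constant C, but
    C splits into parts that they can be moved past. Let f = g i with g real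
    and i^2 a negative real number. The part c^0 of a multivector X with
    respect to i commutes with i, the part c^1 anticommutes with it, and they
    add up to X ([cpart_sum], [cpart_intertwine]). If A Y = Y A', then
    A^j Y = Y A'^j for every j, hence e^A Y = Y e^A' ([mvexp_intertwine]).
    Therefore moving e^(-f) past the part c^b of X only replaces f by (-1)^b f
    ([mvexp_mul], [mul_mvexp]).

    Applying this to the factors one after the other, the nearest to C first,
    expands the integrand into a sum over all tuples of signs. This step uses
    only the exchange relation of the single factors, so it is a statement
    about rings ([expand_prod_left], [expand_prod_right]); the order in which
    the factors meet C explains the two directions of the decompositions.

    The parts of C depend on u but not on x, since i does not depend on x, so
    that they come out of the integral. Multiplication by a constant is a
    linear map of a finite dimensional space, and such maps commute with
    coordinatewise limits and integrals ([mvcvg_linear],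
    [mvintegral_sum_linear]), because every coordinate of the image is a fixed
    linear combination of coordinates ([mvcoef_linear]). The same fact for
    limits serves in [mvexp_intertwine], once the exponential series is known
    to converge ([mvexp_cvg]). *)

(** * Expanding a product along commutation relations *)

(** The induction step for tuples of signs: a tuple of length d.+1 is its
    first entry b followed by a tuple of length d. *)
Lemma sum_ffun_ordS (V : nmodType) (d : nat)
    (G : {ffun 'I_d.+1 -> bool} -> V) :
  \sum_j G j = \sum_b \sum_(j : {ffun 'I_d -> bool})
    G [ffun l => oapp j b (unlift ord0 l)].
Proof.
rewrite pair_big /=.
pose h (bj : bool * {ffun 'I_d -> bool}) : {ffun 'I_d.+1 -> bool} :=
  [ffun l => oapp bj.2 bj.1 (unlift ord0 l)].
rewrite (reindex h) //=.
exists (fun j : {ffun 'I_d.+1 -> bool} =>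
  (j ord0, [ffun l => j (lift ord0 l)])).
  move=> [b j] _; rewrite /h /= ffunE unlift_none; congr pair.
  by apply/ffunP => l; rewrite !ffunE liftK.
move=> j _; apply/ffunP => l; rewrite !ffunE.
by case: unliftP => [k|] -> /=; rewrite ?ffunE.
Qed.

(** Here [c b l] and [E' b] stand for the part c^b with respect to i_l and the
    factors with sign b. The factor of largest index stands next to X and is
    exchanged first, whence the [foldr]; the first factor is exchanged last,
    and the induction on d peels it off. *)
Lemma expand_prod_left (R : pzRingType) (d : nat) (E : 'I_d -> R)
    (E' : bool -> 'I_d -> R) (c : bool -> 'I_d -> R -> R) :
  (forall l X, E l * X = \sum_b c b l X * E' b l) ->
  forall X, (\prod_l E l) * X =
    \sum_(j : {ffun 'I_d -> bool})
      foldr (fun l => c (j l) l) X (enum 'I_d) * \prod_l E' (j l) l.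
Proof.
elim: d E E' c => [|d IHd] E E' c Ec X.
  rewrite big_ord0 mul1r (big_pred1 [ffun=> false]) => [|j].
    by rewrite big_ord0 enum_ord0 mulr1.
  by apply/esym/eqP/ffunP => -[].
rewrite big_ord_recl -mulrA.
rewrite (IHd _ (fun b l => E' b (lift ord0 l))
  (fun b l => c b (lift ord0 l))) //.
rewrite sum_ffun_ordS exchange_big mulr_sumr /=; apply: eq_bigr => j _.
rewrite mulrA Ec mulr_suml; apply: eq_bigr => b _.
rewrite big_ord_recl enum_ordSl /= foldr_map ffunE unlift_none /= mulrA.
congr (c b ord0 _ * _ * _); last first.
  by apply: eq_bigr => l _; rewrite ffunE liftK.
by elim: (enum _) => //= l s ->; rewrite ffunE liftK.
Qed.

(** The mirror image: now the factor of index 0 stands next to X and is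
    exchanged first, so the decomposition is a [foldl] and the induction
    hypothesis is used for the parts of X. *)
Lemma expand_prod_right (R : pzRingType) (d : nat) (E : 'I_d -> R)
    (E' : bool -> 'I_d -> R) (c : bool -> 'I_d -> R -> R) :
  (forall l X, X * E l = \sum_b E' b l * c b l X) ->
  forall X, X * \prod_l E l =
    \sum_(j : {ffun 'I_d -> bool})
      (\prod_l E' (j l) l) * foldl (fun Y l => c (j l) l Y) X (enum 'I_d).
Proof.
elim: d E E' c => [|d IHd] E E' c Ec X.
  rewrite big_ord0 mulr1 (big_pred1 [ffun=> false]) => [|j].
    by rewrite big_ord0 enum_ord0 mul1r.
  by apply/esym/eqP/ffunP => -[].
rewrite big_ord_recl mulrA Ec mulr_suml sum_ffun_ordS; apply: eq_bigr => b _.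
rewrite -mulrA.
rewrite (IHd _ (fun b l => E' b (lift ord0 l))
  (fun b l => c b (lift ord0 l))) //.
rewrite mulr_sumr; apply: eq_bigr => j _.
rewrite big_ord_recl enum_ordSl /= ffunE unlift_none /= mulrA.
congr (_ * _ * _); first by apply: eq_bigr => l _; rewrite ffunE liftK.
elim: (enum _) (c b ord0 X) => //= l s IHs Y.
by rewrite IHs ffunE liftK.
Qed.

Section Multivectors.
Variables (R : realType) (p q : nat).
Local Notation Cl := (clifford R p q).
Implicit Types (A B X Y : Cl).

(** * Coordinatewise limits *)

Lemma mvcoef_linear (L : {linear Cl -> Cl}) A U :
  mvcoef (L A) U = \sum_S mvcoef (L (blade R S)) U * mvcoef A S.
Proof.
rewrite {1}(clifford_blade_sum A) linear_sum mvcoef_sum.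
by apply: eq_bigr => S _; rewrite linearZ mvcoefZ mulrC.
Qed.

Definition mvcvg (F : nat -> Cl) A : Prop :=
  forall S, (mvcoef (F N) S @[N --> \oo] --> mvcoef A S)%classic.

Lemma mvcvg_linear (L : {linear Cl -> Cl}) F A :
  mvcvg F A -> mvcvg (L \o F) (L A).
Proof.
move=> FA U; rewrite mvcoef_linear.
have -> : (fun N => mvcoef ((L \o F) N) U) =
    \sum_S (fun N => mvcoef (L (blade R S)) U * mvcoef (F N) S).
  by apply/funext => N; rewrite /= mvcoef_linear fct_sumE.
elim/big_rec2: _ => [|S y z _ IH]; first exact: cvg_cst.
by apply: cvgD => //; apply: cvgMr; exact: FA.
Qed.

Lemma mvcvg_unique F A B : mvcvg F A -> mvcvg F B -> A = B.
Proof.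
by move=> FA FB; apply: mvcoefP => S; exact: cvg_unique (FA S) (FB S).
Qed.

(** The l^1 norm on coordinates. As the structure constants of the blades are
    signs, it is submultiplicative, which is what bounds the exponential
    series. *)
Definition mvnorm A : R := \sum_S `|mvcoef A S|.

Lemma mvnorm_ge0 A : 0 <= mvnorm A.
Proof. exact: sumr_ge0. Qed.

Lemma normr_blade_sign (S T : {set 'I_(p + q)}) : `|blade_sign R S T| = 1.
Proof.
apply/eqP; rewrite -(@pexpr_eq1 _ _ 2) // -normrX expr2.
by rewrite blade_sign_sq normr1.
Qed.

Lemma mvnormM A B : mvnorm (A * B) <= mvnorm A * mvnorm B.
Proof.
have -> : mvnorm A * mvnorm B =
    \sum_U \sum_S `|mvcoef A S| * `|mvcoef B (symdiff S U)|.
  rewrite exchange_big mulr_suml; apply: eq_bigr => S _ /=.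
  by rewrite mulr_sumr (reindex_inj (inv_inj (symdiffK S))).
apply: ler_sum => U _; rewrite mvcoef_mul.
apply: le_trans (ler_norm_sum _ _ _) _; apply: ler_sum => S _.
by rewrite !normrM normr_blade_sign mul1r.
Qed.

Lemma normr_mvcoef A S : `|mvcoef A S| <= mvnorm A.
Proof. by rewrite /mvnorm (bigD1 S) //= lerDl sumr_ge0. Qed.

(** The factor [mvnorm 1] makes the bound hold at j = 0 without computing the
    norm of 1. *)
Lemma normr_mvcoefX A j S :
  `|mvcoef (A ^+ j) S| <= mvnorm 1 * mvnorm A ^+ j.
Proof.
apply: le_trans (normr_mvcoef _ S) _.
elim: j => [|j IHj]; first by rewrite !expr0 mulr1.
rewrite !exprSr mulrA; apply: le_trans (mvnormM _ _) _.
by rewrite ler_wpM2r // mvnorm_ge0.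
Qed.

(** * The exponential *)

(** The limits in the definition of [mvexp] exist: every coordinate series is
    dominated by a multiple of the real exponential series at [mvnorm A]. *)
Lemma mvexp_cvg A :
  mvcvg (fun N => \sum_(0 <= j < N) j`!%:R^-1 *: A ^+ j) (mvexp A).
Proof.
move=> S; rewrite {2}/mvcoef ffunE.
pose a j : R := j`!%:R^-1 * mvcoef (A ^+ j) S.
have E : (fun N => mvcoef (\sum_(0 <= j < N) j`!%:R^-1 *: A ^+ j) S) = series a.
  apply/funext => N; rewrite mvcoef_sum /series /=.
  by apply: eq_bigr => j _; rewrite mvcoefZ.
rewrite E; apply: normed_cvg.
apply: (@series_le_cvg _ _ (mvnorm 1 *: exp_coeff (mvnorm A))).
- by move=> j; exact: normr_ge0.
- by move=> j; rewrite mulr_ge0 ?mvnorm_ge0 // exp_coeff_ge0 // mvnorm_ge0.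
- move=> j; rewrite /a /= normrM ger0_norm ?invr_ge0 // exp_coeffE.
  rewrite -[leRHS]/(mvnorm 1 * (j`!%:R^-1 * mvnorm A ^+ j)) mulrCA.
  by rewrite ler_wpM2l ?invr_ge0 // normr_mvcoefX.
- by apply: is_cvg_seriesZ; exact: is_cvg_series_exp_coeff.
Qed.

(** The partial sums of the two series are exchanged term by term, and
    multiplication by Y, on either side, passes to the limit. Taking
    A' = A or A' = - A gives the commuting and the anticommuting case at
    once. *)
Lemma mvexp_intertwine A A' Y : A * Y = Y * A' -> mvexp A * Y = Y * mvexp A'.
Proof.
move=> AY.
have AYX j : A ^+ j * Y = Y * A' ^+ j.
  elim: j => [|j IHj]; first by rewrite !expr0 mulr1 mul1r.
  by rewrite !exprSr -mulrA AY mulrA IHj -mulrA.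
apply: (@mvcvg_unique ((Y \o* idfun) \o
    fun N => \sum_(0 <= j < N) j`!%:R^-1 *: A ^+ j)).
  exact: (@mvcvg_linear (Y \o* idfun) _ _ (@mvexp_cvg A)).
have -> : (Y \o* idfun) \o (fun N => \sum_(0 <= j < N) j`!%:R^-1 *: A ^+ j)
    = (Y \*o idfun) \o (fun N => \sum_(0 <= j < N) j`!%:R^-1 *: A' ^+ j).
  apply/funext => N /=; rewrite mulr_suml mulr_sumr; apply: eq_bigr => j _.
  by rewrite -scalerAl AYX scalerAr.
exact: (@mvcvg_linear (Y \*o idfun) _ _ (@mvexp_cvg A')).
Qed.

(** * Commuting and anticommuting parts *)

Lemma cpart_sum B X : \sum_b cpart b B X = X.
Proof.
rewrite big_bool /cpart /=; case: eqP => _; first by rewrite add0r.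
rewrite -scalerDr expr1 expr0 scaleN1r scale1r addrACA addNr addr0.
by rewrite -mulr2n -[X *+ 2]scaler_nat scalerA mulVf ?scale1r ?pnatr_eq0.
Qed.

(** As B^2 is a nonzero real number r, B is invertible and conjugation by B is
    an involution: B^-1 X B B = r B^-1 X = B X. Its eigenspaces for 1 and -1
    are the commuting and the anticommuting multivectors. For B = 0 both sides
    vanish. *)
Lemma cpart_intertwine b B X : imaginary_units B ->
  B * cpart b B X = (-1) ^+ b *: (cpart b B X * B).
Proof.
rewrite /cpart; have [->|B0 [/eqP|]] := eqVneq B 0.
- by move=> _; rewrite mul0r mulr0 scaler0.
- by rewrite (negbTE B0).
move=> [r r0 BB]; have uB : B \is a GRing.unit.
  apply/unitrP; exists (r^-1 *: B).
  by rewrite -scalerAl -scalerAr -expr2 BB scalerA mulVf ?scale1r ?lt_eqF.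
have BVXB : B^-1 * X * B * B = B * X.
  rewrite -mulrA -expr2 BB -scalerAr mulr1 scalerAl.
  by rewrite -mulr_algl -BB expr2 mulrK.
rewrite -scalerAr -scalerAl scalerA mulrC -scalerA; congr (_ *: _).
rewrite mulrDr mulrDl scalerDr -!scalerAr -scalerAl BVXB.
by rewrite -mulrA mulVKr // scalerA -signr_addb addbb scale1r addrC.
Qed.

Lemma cpart_mvexp b (g : R) B X : imaginary_units B ->
  mvexp (- (g *: B)) * cpart b B X =
  cpart b B X * mvexp (- ((-1) ^+ b *: (g *: B))).
Proof.
move=> iB; apply: mvexp_intertwine.
rewrite mulNr mulrN -!scalerAr -scalerAl cpart_intertwine //.
by rewrite !scalerA mulrC.
Qed.

Lemma mvexp_mul (g : R) B X : imaginary_units B ->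
  mvexp (- (g *: B)) * X =
  \sum_(b : bool) cpart b B X * mvexp (- ((-1) ^+ b *: (g *: B))).
Proof.
move=> iB; rewrite -{1}(cpart_sum B X) mulr_sumr.
by apply: eq_bigr => b _; exact: cpart_mvexp.
Qed.

Lemma mul_mvexp (g : R) B X : imaginary_units B ->
  X * mvexp (- (g *: B)) =
  \sum_(b : bool) mvexp (- ((-1) ^+ b *: (g *: B))) * cpart b B X.
Proof.
move=> iB; rewrite -{1}(cpart_sum B X) mulr_suml; apply: eq_bigr => b _.
(* Exchanging the factor with the flipped sign flips the sign back. *)
have := cpart_mvexp b ((-1) ^+ b * g) X iB.
rewrite -[in LHS]scalerA => ->.
by rewrite !scalerA mulrA -signr_addb addbb mul1r.
Qed.

End Multivectors.

(** * Integration *)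

Lemma Rintegral_sum d (T : measurableType d) (R : realType)
    (mu : {measure set T -> \bar R}) (D : set T) (I : Type) (f : I -> T -> R) :
  measurable D -> (forall i, mu.-integrable D (EFin \o f i)) ->
  forall (s : seq I) (P : pred I),
  \int[mu]_(x in D) (\sum_(i <- s | P i) f i x) =
  \sum_(i <- s | P i) \int[mu]_(x in D) f i x.
Proof.
move=> mD fi s P; rewrite /Rintegral sum_fine => [|i _]; last first.
  by apply: integrable_fin_num => //; exact: fi.
rewrite -integral_sum //; congr fine; apply: eq_integral => x _.
by rewrite sumEFin.
Qed.

Section Integral.
Variables (R : realType) (p q m : nat).
Local Notation Cl := (clifford R p q).
Local Notation vec := 'rV[R]_m.

Lemma mvintegral_sum_linear (I : finType) (L : I -> {linear Cl -> Cl})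
    (F : I -> vec -> Cl) : (forall j, mvintegrable (F j)) ->
  mvintegral (fun x => \sum_j L j (F j x)) = \sum_j L j (mvintegral (F j)).
Proof.
move=> iF; apply: mvcoefP => U; rewrite {1}/mvcoef ffunE mvcoef_sum.
pose h j S x := mvcoef (L j (blade R S)) U * mvcoef (F j x) S.
have ih j S : (lebesgue m).-integrable setT (EFin \o h j S).
  exact: (integrableZl measurableT _ (iF j S)).
have -> : (fun x => mvcoef (\sum_j L j (F j x)) U) =
    (fun x => \sum_j \sum_S h j S x).
  apply/funext => x; rewrite mvcoef_sum; apply: eq_bigr => j _.
  exact: mvcoef_linear.
rewrite Rintegral_sum // => [|j]; last first.
  have -> : EFin \o (fun x => \sum_S h j S x) =
      (fun x => \sum_S (EFin \o h j S) x)%E.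
    by apply/funext => x; rewrite /= -sumEFin.
  exact: integrable_sum.
apply: eq_bigr => j _; rewrite Rintegral_sum // mvcoef_linear.
apply: eq_bigr => S _; rewrite [X in _ = _ * X]ffunE; apply: RintegralZl => //.
exact: iF.
Qed.

End Integral.

(** * Transforms of products with a constant factor *)

Theorem theorem6p5 (R : realType) (p q m d1 d2 : nat)
    (F1 : kernels R p q m d1) (F2 : kernels R p q m d2)
    (F1_imaginary : imaginary_kernels F1) (F2_imaginary : imaginary_kernels F2)
    (C : clifford R p q) (A B : 'rV[R]_m -> clifford R p q) :
  (forall (g : 'I_d1 -> 'rV[R]_m -> 'rV[R]_m -> R)
          (i : 'I_d1 -> 'rV[R]_m -> clifford R p q),
     separation F1 g i ->
     (forall x, A x = C * B x) ->
     gft_exists F1 F2 A ->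
     (forall j : {ffun 'I_d1 -> bool}, gft_exists (flip_signs j F1) F2 B) ->
     forall u, gft F1 F2 A u =
       \sum_(j : {ffun 'I_d1 -> bool})
          cpart_left j (fun l => i l u) C * gft (flip_signs j F1) F2 B u) /\
  (forall (g : 'I_d2 -> 'rV[R]_m -> 'rV[R]_m -> R)
          (i : 'I_d2 -> 'rV[R]_m -> clifford R p q),
     separation F2 g i ->
     (forall x, A x = B x * C) ->
     gft_exists F1 F2 A ->
     (forall k : {ffun 'I_d2 -> bool}, gft_exists F1 (flip_signs k F2) B) ->
     forall u, gft F1 F2 A u =
       \sum_(k : {ffun 'I_d2 -> bool})
          gft F1 (flip_signs k F2) B u * cpart_right k (fun l => i l u) C).
Proof.
split=> g i [i_imag Fgi] AE _ B_exists u.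
  rewrite /gft.
  rewrite -(mvintegral_sum_linear (fun j => cpart_left j (i^~ u) C \*o idfun)
    (fun j => B_exists j u)).
  congr mvintegral; apply/funext => x /=.
  rewrite /gft_integrand AE !mulrA.
  rewrite (@expand_prod_left _ _ _
    (fun b l => mvexp (- ((-1) ^+ b *: F1 l x u)))
    (fun b l => cpart b (i l u))) => [|l X]; last first.
    by rewrite Fgi; exact: mvexp_mul.
  by rewrite !mulr_suml; apply: eq_bigr => j _; rewrite !mulrA.
rewrite /gft.
rewrite -(mvintegral_sum_linear (fun k => cpart_right k (i^~ u) C \o* idfun)
  (fun k => B_exists k u)).
congr mvintegral; apply/funext => x /=.
rewrite /gft_integrand AE -!mulrA.
rewrite (@expand_prod_right _ _ _
  (fun b l => mvexp (- ((-1) ^+ b *: F2 l x u)))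
  (fun b l => cpart b (i l u))) => [|l X]; last first.
  by rewrite Fgi; exact: mul_mvexp.
by rewrite !mulr_sumr; apply: eq_bigr => k _; rewrite !mulrA.
Qed.
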